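(* Let $\mathcal{S}$ be an action-based randomization mechanism, $U$ an uncertainty measure and $p$ a prior on $\mathcal{X}$. For each finite strategy $\sigma$ of length $l$ it is possible to build a non-adaptive finite strategy $\sigma'$ of length $|\mathrm{range}(\sigma)|\times l$ such that $I_{\sigma'}(\mathcal{S},p)\geq I_\sigma(\mathcal{S},p)$.
   Context: An action-based randomization mechanism is a 4-tuple $\mathcal{S}=(\mathcal{X},\mathcal{Y},Act,\{M_a:a\in Act\})$ where $\mathcal{X},\mathcal{Y},Act$ are finite nonempty sets and each $M_a$ is a stochastic $|\mathcal{X}|\times|\mathcal{Y}|$ matrix with entries $p_a(y|x)$. An uncertainty measure is a concave continuous function $U:\mathcal{P}\to\mathbb{R}$, $\mathcal{P}$ the set of probability distributions on $\mathcal{X}$. A strategy is a partial function $\sigma:\mathcal{Y}^*\to Act$ with nonempty prefix-closed domain; finite if its domain is finite; its length is $\max\{|\xi|:\xi\in\mathrm{dom}(\sigma)\}+1$; $\mathrm{range}(\sigma)$ is the set of actions it takes as values. A strategy is non-adaptive if $\sigma(y^n)=\sigma(w^n)$ whenever $y^n,w^n$ have the same length (in particular a finite non-adaptive strategy of length $m$ is defined on all sequences of length $<m$). For a prior $p$ and finite $\sigma$, $p_\sigma$ on $\mathcal{X}\times\mathcal{Y}^*$ is: $p_\sigma(x,\varepsilon)=0$ and $p_\sigma(x,y_1,\dots,y_{j+1})=p(x)\prod_{i=1}^{j+1}p_{a_i}(y_i|x)$ with $a_i=\sigma(y_1\cdots y_{i-1})$ if $y_1\cdots y_j\in\mathrm{dom}(\sigma)$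 and $y_1\cdots y_{j+1}\notin\mathrm{dom}(\sigma)$, else $0$. With $(X,Y)\sim p_\sigma$: $I_\sigma(\mathcal{S},p)=U(p)-\sum_{w:\,p_\sigma(w)>0}p_\sigma(w)U(p_\sigma(\cdot|w))$, where $p_\sigma(\cdot|w)$ is the conditional distribution of $X$ given $Y=w$. *)

(* Defs.v *)
From HB Require Import structures.
From mathcomp Require Import all_boot all_order all_algebra finmap.
From mathcomp Require Import all_classical all_reals all_analysis.

Set Implicit Arguments.
Unset Strict Implicit.
Unset Printing Implicit Defensive.

Import Order.TTheory GRing.Theory Num.Theory.
Import numFieldNormedType.Exports.

Local Open Scope classical_set_scope.
Local Open Scope convex_scope.
Local Open Scope ring_scope.

Definition prob_dist (R : realType) (X : finType) : set (X -> R) :=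
  [set p | (forall x, 0 <= p x) /\ \sum_x p x = 1].

Record mechanism (R : realType) := Mechanism {
  secret : finType;
  obs : finType;
  action : finType;
  secret_gt0 : (0 < #|secret|)%N;
  obs_gt0 : (0 < #|obs|)%N;
  action_gt0 : (0 < #|action|)%N;
  kernel : action -> secret -> obs -> R;
  kernel_dist : forall a x, prob_dist (kernel a x) }.

(* Dual of [convex_function]. *)
Definition concave_function (R : numFieldType) (E : lmodType R)
    (E' := convex_lmodType E) (D : set E') (f : E' -> R^o) :=
  forall t : {i01 R},
    {in D &, forall x y : E', f x <| t |> f y <= f (x <| t |> y)}.

(* The values of [U] outside the simplex are unconstrained. As [X] is finite,
   the product topology on [X -> R] is the Euclidean one. *)
Definition uncertainty_measure (R : realType) (X : finType)
    (U : (X -> R) -> R) : Prop :=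
  concave_function (@prob_dist R X) U /\
  {within (@prob_dist R X : set {ptws X -> R}),
     continuous (U : {ptws X -> R} -> R)}.

Section Strategies.
Variables (R : realType) (S : mechanism R).

(* The partial functions with finite domain are the elements of [finMap],
   that is [{fmap seq (obs S) -> action S}]; the word y_1 ... y_n is the list
   [:: y_1; ...; y_n]. *)
Record finite_strategy := FiniteStrategy {
  strategy_map :> finMap (seq (obs S)) (action S);
  strategy_neq0 : domf strategy_map != fset0;
  strategy_prefix_closed : forall v w : seq (obs S),
    prefix v w -> w \in domf strategy_map -> v \in domf strategy_map }.

Implicit Types (s : finite_strategy) (w : seq (obs S)) (p : secret S -> R).

Definition strategy_length s : nat := (\max_(w <- domf s) size w).+1.

(* Equality in [option]: words of equal length are both outside the domain,
   or both inside with the same action. *)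
Definition non_adaptive s : Prop :=
  forall v w, size v = size w -> s.[? v]%fmap = s.[? w]%fmap.

Definition complete_word s w : bool :=
  [&& w != [::], take (size w).-1 w \in domf s & w \notin domf s].

(* The factor p_{a_{i+1}}(y_{i+1} | x), where a_{i+1} = s(y_1 ... y_i). On
   complete words [s] is defined at all proper prefixes, so the default value
   is not used. *)
Definition step_prob s x w (i : 'I_(size w)) : R :=
  if s.[? take i w]%fmap is Some a then kernel a x (tnth (in_tuple w) i)
  else 0.

Definition joint_prob p s x w : R :=
  if complete_word s w then p x * \prod_(i < size w) step_prob s x i else 0.

Definition word_prob p s w : R := \sum_x joint_prob p s x w.

Definition posterior p s w : secret S -> R :=
  fun x => joint_prob p s x w / word_prob p s w.

Definition information (U : (secret S -> R) -> R) p s : R :=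
  U p - \sum_(w \in [set w | 0 < word_prob p s w])
          word_prob p s w * U (posterior p s w).

(* Hence the sum in [information] is a genuine finite sum: [\sum_(w \in A)] is
   0 by convention when the support of the summand in [A] is infinite. *)
Lemma finite_word_prob_gt0 p s : finite_set [set w | 0 < word_prob p s w].
Proof.
pose e (vy : seq (obs S) * obs S) := rcons vy.1 vy.2.
apply: (@sub_finite_set _ _ (e @` ([set` domf s] `*` [set: obs S]))).
  move=> w /=; rewrite /word_prob /joint_prob.
  case: (boolP (complete_word s w)) => [/and3P[w0 wd _] _|_]; last first.
    by rewrite sumr_const mul0rn ltxx.
  case/lastP: w w0 wd => // v y _.
  rewrite -cats1 size_cat addn1 take_size_cat // => vd.
  by exists (v, y) => //; rewrite /e cats1.
by apply/finite_image/finite_setX; [exact: finite_fset|exact: finite_finset].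
Qed.

End Strategies.

(* Main.v *)
(* Let the non-adaptive strategy perform every action of range(sigma) l times.
   A run of sigma can be simulated on the resulting tape of observations: when
   the j-th query of sigma is the action a, read the j-th answer to a. Distinct
   queries read distinct cells, and the cells that are not read sum out, so the
   joint law of sigma is the image of that of the non-adaptive strategy under a
   map of words. Forgetting part of the observation can only lose information:
   summing over words the perspective of U, which is superadditive on
   nonnegative vectors as U is concave, gives the inequality. *)

Require Import Defs.
From HB Require Import structures.
From mathcomp Require Import all_boot all_order all_algebra finmap.
From mathcomp Require Import all_classical all_reals all_analysis.
From mathcomp Require Import ring.

Set Implicit Arguments.
Unset Strict Implicit.
Unset Printing Implicit Defensive.

Import Order.TTheory GRing.Theory Num.Theory.
Local Open Scope ring_scope.

(** * Superadditivity of the perspective of a concave function *)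

Section Perspective.
Variables (R : realType) (X : finType) (U : (X -> R) -> R).

(* The perspective of [U]: homogeneous of degree 1, and 0 at the null vector
   whatever the junk value of [U] there. *)
Definition perspective (q : X -> R) : R :=
  (\sum_x q x) * U (fun x => q x / \sum_z q z).

Lemma perspective0 : perspective (fun=> 0) = 0.
Proof. by rewrite /perspective big1 // mul0r. Qed.

Lemma sum_eq0_fun (q : X -> R) :
  (forall x, 0 <= q x) -> \sum_x q x = 0 -> q = (fun=> 0).
Proof.
move=> q0 /eqP; rewrite psumr_eq0 // => /allP q_eq0.
by apply: funext => x; apply/eqP/q_eq0; rewrite mem_index_enum.
Qed.

(** Concavity is applied to the two normalized vectors, with weights proportional to their masses,
    and the result is multiplied by the total mass. Vectors of mass 0 cannot be normalized and are
    treated apart. *)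
Lemma perspective_superadd (q r : X -> R) :
  concave_function (@prob_dist R X) U ->
  (forall x, 0 <= q x) -> (forall x, 0 <= r x) ->
  perspective q + perspective r <= perspective (fun x => q x + r x).
Proof.
move=> cU q0 r0.
have [/(sum_eq0_fun q0) ->|sq_neq0] := eqVneq (\sum_x q x) 0.
  rewrite perspective0 add0r le_eqVlt; apply/orP/or_introl/eqP.
  by congr perspective; apply: funext => x; rewrite add0r.
have [/(sum_eq0_fun r0) ->|sr_neq0] := eqVneq (\sum_x r x) 0.
  rewrite perspective0 addr0 le_eqVlt; apply/orP/or_introl/eqP.
  by congr perspective; apply: funext => x; rewrite addr0.
rewrite /perspective big_split /=.
set s := \sum_x q x in sq_neq0 *; set t := \sum_x r x in sr_neq0 *.
have s_gt0 : 0 < s by rewrite lt0r sq_neq0 sumr_ge0.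
have t_gt0 : 0 < t by rewrite lt0r sr_neq0 sumr_ge0.
have st_gt0 : 0 < s + t by rewrite addr_gt0.
have l0 : 0 <= s / (s + t) by rewrite divr_ge0 // ltW.
have l1 : s / (s + t) <= 1 by rewrite ler_pdivrMr // mul1r lerDl ltW.
have dq : prob_dist (fun x => q x / s).
  by split=> [x|]; [rewrite divr_ge0 // ltW|rewrite -mulr_suml divff].
have dr : prob_dist (fun x => r x / t).
  by split=> [x|]; [rewrite divr_ge0 // ltW|rewrite -mulr_suml divff].
(* Convex combinations of functions are convertible to this pointwise form. *)
have : s / (s + t) * U (fun x => q x / s) +
       (1 - s / (s + t)) * U (fun x => r x / t) <=
       U (fun x => s / (s + t) * (q x / s) + (1 - s / (s + t)) * (r x / t)).
  exact: cU (Itv01 l0 l1) _ _ (mem_set dq) (mem_set dr).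
have -> : 1 - s / (s + t) = t / (s + t) by field; rewrite gt_eqF.
rewrite -(ler_pM2l st_gt0).
set u := U _; set v := U _.
have -> : (s + t) * (s / (s + t) * u + t / (s + t) * v) = s * u + t * v.
  by field; rewrite gt_eqF.
move=> /le_trans; apply; rewrite le_eqVlt; apply/orP/or_introl/eqP.
congr (_ * U _); apply: funext => x; field.
by rewrite !gt_eqF.
Qed.

Lemma perspective_sum (I : Type) (r : seq I) (P : pred I) (q : I -> X -> R) :
  concave_function (@prob_dist R X) U -> (forall i x, 0 <= q i x) ->
  \sum_(i <- r | P i) perspective (q i) <=
  perspective (fun x => \sum_(i <- r | P i) q i x).
Proof.
move=> cU q0; elim: r => [|i r IHr].
  rewrite big_nil [X in perspective X](_ : _ = fun=> 0) ?perspective0 //.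
  by apply: funext => x; rewrite big_nil.
rewrite [X in perspective X](_ : _ = fun x =>
    (if P i then q i x else 0) + \sum_(j <- r | P j) q j x); last first.
  by apply: funext => x; rewrite big_cons; case: ifP; rewrite ?add0r.
rewrite big_cons; case: ifP => _; last first.
  by rewrite (le_trans IHr) // le_eqVlt; apply/orP/or_introl/eqP;
    congr perspective; apply: funext => x; rewrite add0r.
rewrite (le_trans (lerD (lexx _) IHr)) // perspective_superadd // => x.
exact: sumr_ge0.
Qed.

End Perspective.

(** * Marginals of a product distribution on tuples *)

Lemma prod_sum_tuple (R : comPzSemiRingType) (T : finType) n
    (Q : 'I_n -> pred T) (F : 'I_n -> T -> R) :
  \prod_(i < n) \sum_(o | Q i o) F i o =
  \sum_(t : n.-tuple T | [forall i, Q i (tnth t i)])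
    \prod_(i < n) F i (tnth t i).
Proof.
rewrite bigA_distr_big_dep /=.
rewrite (reindex (fun t : n.-tuple T => [ffun i => tnth t i])) /=; last first.
  exists (fun f : {ffun 'I_n -> T} => [tuple f i | i < n]) => [t _|f _].
    by apply: eq_from_tnth => i; rewrite tnth_mktuple ffunE.
  by apply/ffunP => i; rewrite ffunE tnth_mktuple.
apply: eq_big => [t|t _]; last by apply: eq_bigr => i _; rewrite ffunE.
by rewrite -[LHS]/([forall i, _]); apply: eq_forallb => i; rewrite ffunE.
Qed.

(** The sum factors over coordinates. A coordinate outside the image of [g] is free and contributes
    1; one in the image is bound by a single constraint, as [g] is injective. *)
Lemma sum_tuple_marginal (R : comPzSemiRingType) (T : finType) n m
    (g : 'I_m -> 'I_n) (v : 'I_m -> T) (F : 'I_n -> T -> R) :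
  injective g -> (forall i, \sum_o F i o = 1) ->
  \sum_(t : n.-tuple T | [forall j, tnth t (g j) == v j])
    \prod_(i < n) F i (tnth t i) = \prod_(j < m) F (g j) (v j).
Proof.
move=> g_inj F1.
(* The constraint seen from coordinate [i], vacuous outside the image of [g]. *)
pose Q i o := [forall j, (g j == i) ==> (o == v j)].
rewrite (eq_bigl (fun t : n.-tuple T => [forall i, Q i (tnth t i)])).
  rewrite -prod_sum_tuple (bigID (mem [set g j | j in [set: 'I_m]])) /=.
  rewrite big_imset /=; last by move=> i j _ _; exact: g_inj.
  rewrite [X in _ * X]big1 ?mulr1 => [|i /negP gi].
    rewrite big_set; apply: eq_bigr => j _; rewrite (big_pred1 (v j)) // => o.
    rewrite /= /Q; apply/forallP/eqP => [/(_ j)|-> j']; first by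
      rewrite eqxx => /eqP.
    by apply/implyP => /eqP/g_inj ->.
  rewrite -(F1 i); apply: eq_bigl => o; apply/forallP => j.
  by apply/implyP => /eqP gji; case: gi; rewrite -gji imset_f.
move=> t; apply/forallP/forallP => [tv i|tQ j].
  by apply/forallP => j; apply/implyP => /eqP <-.
by have /forallP/(_ j) := tQ (g j); rewrite eqxx.
Qed.

(** * Complete words, and information as a sum over a list *)

Section Strategies.
Variables (R : realType) (S : mechanism R).
Implicit Types (s : finite_strategy S) (w : seq (obs S)) (p : secret S -> R).

Lemma nil_strategy s : [::] \in domf s.
Proof.
have /fset0Pn[w] := strategy_neq0 s.
exact/strategy_prefix_closed/prefix0s.
Qed.

Lemma size_strategy s w : w \in domf s -> (size w < strategy_length s)%N.
Proof. by move=> ws; rewrite ltnS; exact: leq_bigmax_seq. Qed.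

Lemma complete_take s w j :
  complete_word s w -> (take j w \in domf s) = (j < size w)%N.
Proof.
case/and3P=> w0 ws wNs; case: ltnP => [jw|wj]; last first.
  by rewrite take_oversize //; exact/negbTE.
have jw1 : (j <= (size w).-1)%N by rewrite -ltnS (ltn_predK jw).
by apply: strategy_prefix_closed ws; rewrite -(take_takel w jw1) prefix_take.
Qed.

Lemma joint_prob_ge0 p s x w :
  (forall x, 0 <= p x) -> 0 <= joint_prob p s x w.
Proof.
move=> p0; rewrite /joint_prob; case: ifP => // _.
rewrite mulr_ge0 // prodr_ge0 // => i _; rewrite /step_prob.
by case: fnd => // a; case: (kernel_dist a x).
Qed.

(** Each term of [information] is a perspective by definition, and it vanishes on words of
    probability 0, so the support may be enlarged. *)
Lemma information_seq (U : (secret S -> R) -> R) p s (r : seq (seq (obs S))) :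
  (forall x, 0 <= p x) -> uniq r -> (forall w, 0 < word_prob p s w -> w \in r) ->
  information U p s =
  U p - \sum_(w <- r) perspective U (fun x => joint_prob p s x w).
Proof.
move=> p0 r_uniq rP; congr (_ - _).
apply: fsbig_fwiden => // w [_ /= /negP].
rewrite lt0r negb_and sumr_ge0 ?orbF; last by move=> x _; exact: joint_prob_ge0.
by move=> /negPn/eqP w0; rewrite /preimage/= /perspective -/(word_prob p s w) w0 mul0r.
Qed.

(** * Strategies whose action depends on the step alone *)

Section OpenLoop.
Variables (m : nat) (act : nat -> action S).

Definition short_words : {fset seq (obs S)} :=
  [fset bseqval b | b in {: m.-bseq (obs S)}]%fset.

Lemma in_short_words w : (w \in short_words) = (size w <= m)%N.
Proof.
apply/imfsetP/idP => [[b _ ->]|wm]; first exact: size_bseq.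
by exists (Bseq wm).
Qed.

Definition open_loop_map : finMap (seq (obs S)) (action S) :=
  [fmap w : short_words => act (size (val w))]%fmap.

Lemma open_loop_neq0 : domf open_loop_map != fset0.
Proof. by apply/fset0Pn; exists [::]; rewrite in_short_words. Qed.

Lemma open_loop_prefix_closed v w :
  prefix v w -> w \in domf open_loop_map -> v \in domf open_loop_map.
Proof.
by move=> /size_prefix vw; rewrite !in_short_words; exact: leq_trans.
Qed.

Definition open_loop := FiniteStrategy open_loop_neq0 open_loop_prefix_closed.

Lemma open_loopE w :
  open_loop.[? w]%fmap = if (size w <= m)%N then Some (act (size w)) else None.
Proof.
rewrite -in_short_words; case: ifPn => [ws|wNs]; last exact: not_fnd.
by rewrite (in_fnd (f := open_loop) ws) ffunE.
Qed.

Lemma non_adaptive_open_loop : non_adaptive open_loop.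
Proof. by move=> v w vw; rewrite !open_loopE vw. Qed.

Lemma strategy_length_open_loop : strategy_length open_loop = m.+1.
Proof.
have /card_gt0P[y _] := obs_gt0 S.
apply/eqP; rewrite eqn_leq; apply/andP; split.
  by apply/bigmax_leqP_seq => w; rewrite in_short_words.
have /size_strategy : nseq m y \in domf open_loop.
  by rewrite in_short_words size_nseq.
by rewrite size_nseq.
Qed.

Lemma complete_open_loop w : complete_word open_loop w = (size w == m.+1).
Proof.
rewrite /complete_word !in_short_words -ltnNge.
case: w => [|y w] //=; rewrite ltnS eqSS size_take_min eqn_leq.
by rewrite (minn_idPl _).
Qed.

Lemma joint_prob_open_loop p x (t : m.+1.-tuple (obs S)) :
  joint_prob p open_loop x t =
  p x * \prod_(i < m.+1) Defs.kernel (act i) x (tnth t i).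
Proof.
have ct : complete_word open_loop t by rewrite complete_open_loop size_tuple.
rewrite /joint_prob ct; congr (_ * _).
pose y0 := tnth t ord0.
(* The index types ['I_(size t)] and ['I_m.+1] differ; a product indexed by [nat] links them. *)
transitivity (\prod_(0 <= i < size t) Defs.kernel (act i) x (nth y0 t i)).
  rewrite big_mkord; apply: eq_bigr => i _; rewrite /step_prob open_loopE.
  have it : (i <= size t)%N by exact: ltnW.
  have := ltn_ord i; rewrite [X in (_ < X)%N]size_tuple => im.
  by rewrite size_takel // -ltnS im (tnth_nth y0).
rewrite size_tuple big_mkord; apply: eq_bigr => i _.
by rewrite (tnth_nth y0).
Qed.

End OpenLoop.

(** * Simulating a strategy on a tape of answers *)

Section Simulation.
Variables (s : finite_strategy S) (slot : action S -> nat -> nat).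

(* Runs [s] for [n] steps, reading the answer to the [j]-th query, when that
   query is the action [a], in the cell [slot a j] of the tape [y]. *)
Fixpoint simulate (y : nat -> obs S) n : seq (obs S) :=
  if n is n'.+1 then
    let v := simulate y n' in
    if s.[? v]%fmap is Some a then rcons v (y (slot a (size v))) else v
  else [::].

(** Agreement of tape and word split into one condition per step, the form that [sum_tuple_marginal]
    calls for. *)
Definition follows (y : nat -> obs S) w : Prop :=
  forall j, (j < size w)%N -> exists2 a, s.[? take j w]%fmap = Some a &
    take j.+1 w = rcons (take j w) (y (slot a j)).

Lemma simulate_follows y n : follows y (simulate y n).
Proof.
elim: n => [j //|n IHn] /=; case sv: fnd => [a|//] j.
set v := simulate y n in IHn sv *.
rewrite size_rcons ltnS leq_eqVlt => /predU1P[->|jv].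
  exists a; first by rewrite -cats1 take_size_cat.
  by rewrite take_oversize ?size_rcons // -!cats1 take_size_cat.
have [b sb vb] := IHn j jv; exists b; by rewrite -cats1 !takel_cat //; exact: ltnW.
Qed.

(** A run that leaves the domain stays put, so a run still inside has grown at every step. *)
Lemma size_simulate y n : simulate y n \in domf s -> size (simulate y n) = n.
Proof.
elim: n => [|n IHn] //=; case sv: fnd => [a|] => [_|vs].
  by rewrite size_rcons IHn // -fndSome sv.
by move: vs; rewrite -fndSome sv.
Qed.

Lemma complete_simulate y : complete_word s (simulate y (strategy_length s)).
Proof.
set v := simulate _ _.
have vNs : v \notin domf s.
  by apply/negP => vs; have := size_strategy vs; rewrite size_simulate ?ltnn.
have v0 : v != [::].
  by apply: contraNneq vNs => ->; exact: nil_strategy.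
rewrite /complete_word v0 vNs andbT /=.
have [] := @simulate_follows y (strategy_length s) (size v).-1.
  by rewrite ltn_predL lt0n size_eq0.
by move=> a sa _; rewrite -fndSome sa.
Qed.

Lemma follows_simulate y w n :
  complete_word s w -> follows y w -> simulate y n = take n w.
Proof.
move=> cw yw; elim: n => [|n /= ->]; first by rewrite take0.
have [nw|wn] := ltnP n (size w).
  by have [a -> ->] := yw n nw; rewrite size_takel // ltnW.
rewrite not_fnd; last by rewrite complete_take // -leqNgt.
by rewrite !take_oversize // leqW.
Qed.

Lemma simulateP y w : complete_word s w ->
  simulate y (strategy_length s) = w <-> follows y w.
Proof.
move=> cw; split => [<-|yw]; first exact: simulate_follows.
rewrite (follows_simulate _ cw yw) take_oversize //.
(* A complete word has one letter more than some word of the domain, so its size is at most the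
   strategy length. *)
have /size_strategy : take (size w).-1 w \in domf s by case/and3P: cw.
by rewrite size_takel ?leq_pred // ltnS -ltnS; apply: leq_trans; exact: leqSpred.
Qed.

Variables (m : nat) (act : nat -> action S).
Hypothesis slot_lt : forall w a j, s.[? w]%fmap = Some a ->
  (j < strategy_length s)%N -> (slot a j < m.+1)%N.
Hypothesis slotK : forall w a j, s.[? w]%fmap = Some a ->
  (j < strategy_length s)%N -> act (slot a j) = a.
(* A run makes a single query at step [j], hence cells need only separate the
   steps. *)
Hypothesis slot_inj : forall v w a b i j,
  s.[? v]%fmap = Some a -> s.[? w]%fmap = Some b ->
  (i < strategy_length s)%N -> (j < strategy_length s)%N ->
  slot a i = slot b j -> i = j.

(** A tape of [m.+1] cells is nonempty, so its head can serve as the default of [nth]. *)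
Definition readout (t : m.+1.-tuple (obs S)) : seq (obs S) :=
  simulate (nth (thead t) t) (strategy_length s).

(** For complete [w], the tapes read out as [w] are those with prescribed letters in distinct cells,
    and the other cells sum out. Otherwise both sides are 0, since every readout is complete. *)
Lemma joint_prob_simulate p x w :
  joint_prob p s x w =
  \sum_(t | readout t == w) joint_prob p (open_loop m act) x t.
Proof.
rewrite [LHS]/joint_prob; case: ifPn => [cw|/negP cNw]; last first.
  rewrite big_pred0 // => t; apply/eqP => tw; apply: cNw; rewrite -tw.
  exact: complete_simulate.
have sj (j : 'I_(size w)) : {a | s.[? take j w]%fmap = Some a}.
  have : take j w \in domf s by rewrite complete_take.
  by rewrite -fndSome; case: fnd => // a _; exists a.
have jl (j : 'I_(size w)) : (j < strategy_length s)%N.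
  have := size_strategy (s := s) (w := take j w).
  by rewrite complete_take // size_takel; [exact|exact: ltnW].
(* The cell read at step [j] by a run that produces [w]. *)
pose g j : 'I_m.+1 := Ordinal (slot_lt (svalP (sj j)) (jl j)).
have g_inj : injective g.
  move=> i j [] /(slot_inj (svalP (sj i)) (svalP (sj j)) (jl i) (jl j)).
  exact: val_inj.
under [RHS]eq_bigr do rewrite joint_prob_open_loop.
rewrite -mulr_sumr; congr (_ * _).
rewrite (eq_bigl (fun t : m.+1.-tuple (obs S) =>
    [forall j, tnth t (g j) == tnth (in_tuple w) j])).
  rewrite (sum_tuple_marginal (F := fun i : 'I_m.+1 => Defs.kernel (act i) x) _ g_inj);
    last first.
    by move=> i; case: (kernel_dist (act i) x).
  apply: eq_bigr => j _; rewrite /step_prob (svalP (sj j)) /=.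
  by rewrite (slotK (svalP (sj j))).
move=> t; apply/eqP/forallP => [/(simulateP _ cw) tw j|tw].
  have [a] := tw j (ltn_ord j).
  rewrite (svalP (sj j)) => -[<-].
  rewrite (take_nth (thead t)) // => /rcons_inj[wj].
  by rewrite !(tnth_nth (thead t)) wj.
apply/(simulateP _ cw) => j jw; exists (sval (sj (Ordinal jw))).
  exact: svalP (sj (Ordinal jw)).
have /eqP := tw (Ordinal jw); rewrite !(tnth_nth (thead t)) /= => ->.
by rewrite -take_nth.
Qed.

Lemma information_simulate (U : (secret S -> R) -> R) p :
  concave_function (@prob_dist R (secret S)) U -> (forall x, 0 <= p x) ->
  information U p s <= information U p (open_loop m act).
Proof.
move=> cU p0.
pose J' (t : m.+1.-tuple (obs S)) x := joint_prob p (open_loop m act) x t.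
have J'0 t x : 0 <= J' t x by exact: joint_prob_ge0.
rewrite (@information_seq U p (open_loop m act)
  [seq val t | t : m.+1.-tuple (obs S)]) //; last 2 first.
- by rewrite map_inj_uniq ?enum_uniq //; exact: val_inj.
- move=> w; case: (boolP (size w == m.+1)) => [wm _|wm].
    by apply/mapP; exists (Tuple wm); rewrite ?mem_enum.
  rewrite /word_prob big1 ?ltxx // => x _.
  by rewrite /joint_prob complete_open_loop (negbTE wm).
(* A word that is no readout has an empty fibre, hence probability 0. *)
rewrite (@information_seq U p s
  (undup [seq readout t | t : m.+1.-tuple (obs S)])) ?undup_uniq //; last first.
  move=> w; rewrite mem_undup; apply: contraLR => /negP wNr.
  rewrite /word_prob big1 ?ltxx // => x _.
  rewrite joint_prob_simulate big_pred0 // => t.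
  by apply/eqP => tw; apply: wNr; rewrite -tw map_f ?mem_enum.
rewrite lerD2l lerN2 big_map big_enum /=.
set r := undup _.
(* The fibres of [readout] partition the tapes; superadditivity is then used within each fibre. *)
have -> : \sum_t perspective U (J' t) =
    \sum_(w <- r) \sum_(t | readout t == w) perspective U (J' t).
  rewrite (exchange_big_dep xpredT) //=; apply: eq_bigr => t _.
  rewrite (eq_bigl (pred1 (readout t))) => [|w]; last by rewrite /= eq_sym.
  rewrite -big_filter filter_pred1_uniq ?big_seq1 ?undup_uniq //.
  by rewrite mem_undup map_f ?mem_enum.
apply: ler_sum => w _; apply: (le_trans (perspective_sum _ _ cU J'0)).
rewrite le_eqVlt; apply/orP/or_introl/eqP; congr perspective.
by apply: funext => x; rewrite joint_prob_simulate.
Qed.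

End Simulation.

End Strategies.

Theorem theorem4p5 (R : realType) (S : mechanism R)
    (U : (secret S -> R) -> R) (hU : uncertainty_measure U)
    (p : secret S -> R) (hp : prob_dist p)
    (sigma : finite_strategy S) (l : nat) (hl : strategy_length sigma = l) :
  exists sigma' : finite_strategy S,
    [/\ non_adaptive sigma',
        strategy_length sigma' = (#|` codomf sigma| * l)%N &
        information U p sigma <= information U p sigma'].
Proof.
have /card_gt0P[a0 _] := action_gt0 S.
pose A := enum_fset (codomf sigma).
have A_index w a : sigma.[? w]%fmap = Some a -> (index a A < size A)%N.
  by move=> wa; rewrite index_mem; apply/codomfP; exists w.
have l_gt0 : (0 < l)%N by rewrite -hl.
have A_gt0 : (0 < size A)%N.
  have := nil_strategy sigma; rewrite -fndSome.
  by case sa: fnd => [a|//] _; exact: leq_ltn_trans (A_index _ _ sa).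
(* The tape consists of one block of [l] cells per action: the quotient by [l] gives the action, the
   remainder the step. *)
pose slot a j := (index a A * l + j)%N.
pose act i := nth a0 A (i %/ l).
(* [open_loop m] has length [m.+1], hence the predecessor. *)
have AlE : (size A * l).-1.+1 = (size A * l)%N by rewrite prednK ?muln_gt0 ?A_gt0.
have slot_div a j : (j < l)%N -> (slot a j %/ l)%N = index a A.
  by move=> jl; rewrite divnMDl // divn_small ?addn0.
exists (open_loop (size A * l).-1 act); split.
- exact: non_adaptive_open_loop.
- by rewrite strategy_length_open_loop AlE.
- apply: (information_simulate (slot := slot)); rewrite ?hl.
  + move=> w a j /A_index aA jl; rewrite AlE.
    by rewrite -ltn_divLR // slot_div.
  + move=> w a j wa jl; rewrite /act slot_div // nth_index //.
    by rewrite -index_mem (A_index _ _ wa).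
  + move=> v w a b i j _ _ il jl /(congr1 (modn^~ l)).
    by rewrite !modnMDl !modn_small.
  + by case: hU.
  + by case: hp.
Qed.
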